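(* The expected time complexity of the algorithm described below on undirected graphs is \[ \widetilde{O}\left(\frac{1}{\varepsilon}\sqrt{\sum_{t\in V}\pi(s,t)d(t)}\right). \] Furthermore, this complexity is upper bounded by $\widetilde{O}\big(\sqrt{d_{\max}}/\varepsilon\big)$.
   Context: Let $G=(V,E)$ be an undirected graph (each edge viewed as two opposing directed edges) with $|V|=n$, $|E|=m$, degrees $d(v)\ge 1$ and $d_{\max}=\max_v d(v)$. For a constant decay factor $\alpha\in(0,1)$, an $\alpha$-discounted random walk from $s$ terminates with probability $\alpha$ before each step and otherwise moves to a uniformly random neighbor; $\pi(s,t)$ is the probability it terminates at $t$. $\widetilde{O}(\cdot)$ suppresses $\mathrm{polylog}(n)$ factors. On undirected graphs PPR satisfies the symmetry $\pi(u,v)d(u)=\pi(v,u)d(v)$. Backward Push for target $t$ with threshold $r_{\max}$: initialize reserves $q(v,t)=0$ for all $v$, residues $r(t,t)=1$ and $r(v,t)=0$ otherwise; while some $v$ has $r(v,t)>r_{\max}$, add $(1-\alpha)r(v,t)/d(u)$ to $r(u,t)$ for each neighbor $u$ of $v$, add $\alpha r(v,t)$ to $q(v,t)$, and set $r(v,t)=0$. It guarantees $r(v,t)\le r_{\max}$, the invariant $\pi(v,t)=q(v,t)+\sum_{u}\pi(v,u)r(u,t)$, and runs in time $O\big(\frac{1}{r_{\max}}\sum_{v\in V}\pi(v,t)d(v)\big)$. Monte Carlo with $k$ walks estimates $\pi(s,v)$ as the fraction of $k$ independent $\alpha$-discounted walks from $s$ terminating at $v$. The algorithm (given source $s$ and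 error $\varepsilon$): Phase I runs Monte Carlo with $\lceil 12\ln(2n^3)/\varepsilon\rceil$ walks to get $\pi'(s,v)$ and sets candidate set $C=\{t:\pi'(s,t)>\varepsilon/2\}$. Phase II sets $n_r=\lceil n/\varepsilon\rceil$, $n_t=\lceil 18\ln(2n^2)\rceil$, $r_{\max}(t)=\frac{\varepsilon^2 n_r}{6\pi'(s,t)}$ for $t\in C$; it repeatedly tries Backward Push for every $t\in C$ with threshold $\frac12 r_{\max}(t)$, and if the total cost in this iteration exceeds the expected cost of simulating $n_t\cdot\frac12 n_r$ random walks it stops; otherwise it halves $n_r$ (floor) and all $r_{\max}(t)$ and repeats. After stopping, it runs Backward Push for each $t\in C$ with the current $r_{\max}(t)$. Phase III, repeated $n_t$ times independently, runs Monte Carlo with $n_r$ walks giving $\pi''(s,v)$ and computes $\hat\pi_i(s,t)=q(s,t)+\sum_{v}\pi''(s,v)r(v,t)$ for $t\in C$; the output is the median over $i$ for $t\in C$ and $0$ for $t\notin C$. With probability at least $1-1/n^2$ Phase I succeeds, in which case all $t\in C$ satisfy $\frac12\pi(s,t)\le\pi'(s,t)\le\frac32\pi(s,t)$. The doubling/stopping scheme achieves, up to constants, the cost obtained with the optimal $n_r$ balancing Phases II and III; on general directed graphs this yields expected complexity $\widetilde{O}\big(\frac{1}{\varepsilon}\sqrt{\sum_{t}\pi(s,t)\sum_{v}\pi(v,t)d_{\mathrm{in}}(v)}\big)$, with $d_{\mathrm{in}}(v)=d(v)$ in the undirected case. *)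

(* Defs.v *)
From HB Require Import structures.
From mathcomp Require Import all_boot all_order all_algebra.
From mathcomp Require Import all_classical all_reals all_analysis.
From mathcomp Require Import lra.

Set Implicit Arguments.
Unset Strict Implicit.
Unset Printing Implicit Defensive.

Import Order.TTheory GRing.Theory Num.Theory.

Local Open Scope classical_set_scope.
Local Open Scope ring_scope.

Record ugraph := UGraph {
  vertex :> finType;
  adj : rel vertex;
  adj_sym : symmetric adj;
  adj_irr : irreflexive adj;
  adj_gt0 : forall v, (0 < #|adj v|)%N }.

Definition deg (G : ugraph) (v : G) : nat := #|adj v|.

Definition dmax (G : ugraph) : nat := \max_(v : G) deg v.

Section Walks.
Variables (R : realType) (alpha : R) (G : ugraph).

(* A walk from [s] is the list [w] of the vertices visited after [s]; it
   terminates at [last s w].  At every vertex of [belast s w] the walk survives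
   with probability [1 - alpha] and moves to one of the neighbours uniformly. *)
Definition walk_prob (s : G) (w : seq G) : R :=
  if path (@adj G) s w
  then (\prod_(v <- belast s w) ((1 - alpha) / (deg v)%:R)) * alpha
  else 0.

Definition ppr (s t : G) : R :=
  fine (\esum_(w in [set w | last s w = t]) (walk_prob s w)%:E)%E.

(* One unit to start the walk, one per step. *)
Definition walk_cost (w : seq G) : nat := (size w).+1.

Definition mean_walk_cost (s : G) : R :=
  fine (\esum_(w in [set: seq G]) (walk_prob s w * (walk_cost w)%:R)%:E)%E.

Definition monte_carlo (s : G) (ws : seq (seq G)) (v : G) : R :=
  (count (fun w => last s w == v) ws)%:R / (size ws)%:R.

End Walks.

(* [W 0], [W 1], ... are mutually independent alpha-discounted walks from [s].
   [seq G] is countable, so measurability of the fibres suffices. *)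
Record iid_walks (R : realType) (alpha : R) (G : ugraph) (s : G)
    (d : measure_display) (Omega : measurableType d) (P : probability Omega R)
    (W : nat -> Omega -> seq G) : Prop := IidWalks {
  iid_walks_meas : forall i w, measurable (W i @^-1` [set w]);
  iid_walks_law : forall i w, P (W i @^-1` [set w]) = (walk_prob alpha s w)%:E;
  iid_walks_indep : forall (J : seq nat) (A : nat -> set (seq G)), uniq J ->
    P (\big[setI/setT]_(i <- J) (W i @^-1` A i)) =
    (\prod_(i <- J) P (W i @^-1` A i))%E }.

Section BackwardPush.
Variables (R : realType) (alpha : R) (G : ugraph).

(* (reserves, residues) *)
Definition bp_state : Type := (G -> R) * (G -> R).

Definition bp_init (t : G) : bp_state := (fun=> 0, fun v => (v == t)%:R).

Definition bp_push (st : bp_state) (v : G) : bp_state :=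
  let: (q, r) := st in
  (fun u => if u == v then q u + alpha * r v else q u,
   fun u => if u == v then 0
            else if adj v u then r u + (1 - alpha) * r v / (deg u)%:R
            else r u).

Definition bp_after (t : G) (h : seq G) : bp_state :=
  foldl bp_push (bp_init t) h.

Definition bp_active (t : G) (rmax : R) (h : seq G) : bool :=
  [exists v, rmax < (bp_after t h).2 v].

(* Backward Push does not say which vertex above the threshold is pushed next.
   An implementation of this choice maps the target, the threshold and the list
   of the vertices pushed so far to the next vertex. *)
Definition push_order : Type := G -> R -> seq G -> G.

Definition valid_order (ord : push_order) : Prop :=
  forall t rmax h, bp_active t rmax h ->
    rmax < (bp_after t h).2 (ord t rmax h).

Variable ord : push_order.

Definition bp_step (t : G) (rmax : R) (h : seq G) : seq G :=
  if bp_active t rmax h then rcons h (ord t rmax h) else h.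

(* The vertices pushed by the whole run; see [bp_run_halts]. *)
Definition bp_run (t : G) (rmax : R) : seq G :=
  iter (xget 0%N [set k | ~~ bp_active t rmax (iter k (bp_step t rmax) [::])])
    (bp_step t rmax) [::].

Definition bp_reserve (t : G) (rmax : R) : G -> R := (bp_after t (bp_run t rmax)).1.

Definition bp_residue (t : G) (rmax : R) : G -> R := (bp_after t (bp_run t rmax)).2.

(* One unit for the initialisation; a push at [v] takes one unit for the reserve
   and residue of [v] and one unit for each neighbour of [v]. *)
Definition bp_cost (t : G) (rmax : R) : nat :=
  (1 + \sum_(v <- bp_run t rmax) (1 + deg v))%N.

End BackwardPush.

Section Algorithm.
Variables (R : realType) (alpha : R) (G : ugraph).
Variables (ord : push_order R G) (s : G) (eps : R).

Definition nceil (x : R) : nat := `|Num.ceil x|%N.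

Definition n_first : nat := nceil (12 * ln (2 * #|G|%:R ^+ 3) / eps).

Definition n_t : nat := nceil (18 * ln (2 * #|G|%:R ^+ 2)).

Definition n_r0 : nat := nceil (#|G|%:R / eps).

Section PhaseTwo.
(* The estimates of Phase I. *)
Variable pi1 : G -> R.

Definition candidates : {set G} := [set t | eps / 2 < pi1 t].

(* Values of [n_r] and [r_max] after [i] halvings. *)
Definition n_r (i : nat) : nat := iter i half n_r0.

Definition r_max (i : nat) (t : G) : R :=
  eps ^+ 2 * n_r0%:R / (6 * pi1 t) / 2 ^+ i.

(* Cost of the attempt in iteration [i] when it is not interrupted; one unit is
   for the loop itself, so the cost is positive even if there is no candidate. *)
Definition try_cost (i : nat) : nat :=
  (1 + \sum_(t in candidates) bp_cost alpha ord t (r_max i t / 2))%N.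

Definition budget (i : nat) : R :=
  n_t%:R * (n_r i)%:R / 2 * mean_walk_cost alpha s.

Definition try_stops (i : nat) : bool := budget i < (try_cost i)%:R.

Lemma try_stops_ex : exists i, try_stops i.
Proof.
exists n_r0; rewrite /try_stops /budget.
suff -> : n_r n_r0 = 0%N by rewrite mulr0 !mul0r ltr0n /try_cost.
rewrite /n_r; set m := n_r0.
suff H k : (iter k half m <= m - k)%N.
  by apply/eqP; rewrite -leqn0; apply: leq_trans (H m) _; rewrite subnn.
elim: k => [|k IH] /=; first by rewrite subn0.
apply: leq_trans (half_leq IH) _; rewrite subnS.
by case: (m - k)%N => // j; rewrite leq_half_double -addnn /= -addSn leq_addr.
Qed.

Definition stop_index : nat := ex_minn try_stops_ex.

(* An attempt is interrupted as soon as the number of units spent exceeds the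
   budget. *)
Definition try_spent (i : nat) : nat :=
  minn (try_cost i) (Num.truncn (budget i)).+1.

Definition phase2_cost : nat :=
  (\sum_(0 <= i < stop_index.+1) try_spent i +
   \sum_(t in candidates) bp_cost alpha ord t (r_max stop_index t))%N.

End PhaseTwo.

Definition median (x : seq R) : R := nth 0 (sort <=%R x) (size x)./2.

(* The algorithm as a function of the successive walks it simulates: Phase I
   takes the first [n_first] of them and round [i] of Phase III the [i]-th of
   the following blocks of [n_r] walks.  Result: the output and the time. *)
Definition ssppr (W : nat -> seq G) : (G -> R) * nat :=
  let walks1 := [seq W j | j <- iota 0 n_first] in
  let pi1 := monte_carlo R s walks1 in
  let C := candidates pi1 in
  let k := stop_index pi1 in
  let nr := n_r k in
  let q t := bp_reserve alpha ord t (r_max pi1 k t) in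
  let r t := bp_residue alpha ord t (r_max pi1 k t) in
  let walks3 i := [seq W j | j <- iota (n_first + i * nr) nr] in
  let est i t := q t s + \sum_v monte_carlo R s (walks3 i) v * r t v in
  let out t := if t \in C then median [seq est i t | i <- iota 0 n_t] else 0 in
  (* One unit per sample for collecting the candidates. *)
  let cost1 := (\sum_(w <- walks1) walk_cost w + n_first)%N in
  (* The sum in [est i t] runs over the nonzero residues; a median of [n_t]
     numbers takes linear time. *)
  let cost3 := (\sum_(0 <= i < n_t)
      (\sum_(w <- walks3 i) walk_cost w
       + \sum_(t in C) (1 + #|[pred v | r t v != 0%R]|))
    + \sum_(t in C) n_t)%N in
  (out, (cost1 + phase2_cost pi1 + cost3)%N).

End Algorithm.

Record input (R : realType) (alpha : R) := Input {
  graph : ugraph;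
  source : graph;
  eps : R;
  eps_range : 0 < eps <= 1;
  rule : push_order R graph;
  rule_valid : valid_order alpha rule;
  disp : measure_display;
  sample : measurableType disp;
  prob : probability sample R;
  walks : nat -> sample -> seq graph;
  walks_iid : iid_walks alpha source prob walks }.

Definition expected_time (R : realType) (alpha : R) (x : input alpha) : \bar R :=
  expectation (prob x) (fun omega =>
    ((ssppr alpha (@rule _ _ x) (source x) (eps x)
        (fun j => walks j omega)).2)%:R).

(* [f = O~(g)], where the factor is polylogarithmic in the number of vertices. *)
Definition softO (R : realType) (alpha : R) (f : input alpha -> \bar R)
    (g : input alpha -> R) : Prop :=
  exists (K : R) (k : nat), forall x : input alpha,
    (f x <= (K * ln #|graph x|%:R ^+ k * g x)%:E)%E.

Section Termination.
Variables (R : realType) (alpha : R) (G : ugraph).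
Hypothesis alpha01 : 0 < alpha < 1.
Variables (ord : push_order R G) (ordP : valid_order alpha ord).
Variables (t : G) (rmax : R).
Hypothesis rmax_gt0 : 0 < rmax.

Let Phi (st : bp_state R G) : R := \sum_u st.2 u * (deg u)%:R.

Lemma bp_push_potential (st : bp_state R G) (v : G) :
  Phi (bp_push alpha st v) = Phi st - alpha * st.2 v * (deg v)%:R.
Proof.
case: st => q r; rewrite /Phi /= (bigD1 v) //= eqxx mul0r add0r.
rewrite [in RHS](bigD1 v) //=.
under eq_bigr => u uv.
  rewrite (negbTE uv) (_ : (if _ then _ else _) * _ = r u * (deg u)%:R +
    (if adj v u then (1 - alpha) * r v else 0)); last first.
    case: ifP => _; last by rewrite addr0.
    rewrite mulrDl divfK // pnatr_eq0 -lt0n; exact: adj_gt0.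
  over.
rewrite big_split /= -big_mkcondr /=.
rewrite [X in _ + X = _](eq_bigl (mem (adj v))); last first.
  move=> u /=; case: (eqVneq u v) => [->|_] /=; [exact: (esym (adj_irr v))|exact: erefl].
rewrite sumr_const -mulr_natr -/(deg v); lra.
Qed.

Lemma bp_push_ge0 (st : bp_state R G) (v : G) :
  (forall u, 0 <= st.2 u) -> forall u, 0 <= (bp_push alpha st v).2 u.
Proof.
case: st => q r /= r0 u; case: ifP => // _; case: ifP => // _.
by case/andP: alpha01 => _ a1; rewrite addr_ge0 // divr_ge0 // mulr_ge0 // subr_ge0 ltW.
Qed.

Lemma bp_run_halts : ~~ bp_active alpha t rmax (bp_run alpha ord t rmax).
Proof.
set h := fun k => iter k (bp_step alpha ord t rmax) [::].
suff [k hk] : exists k, ~~ bp_active alpha t rmax (h k).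
  by rewrite /bp_run; case: xgetP => [j _ //|/(_ k)]; rewrite /= hk.
apply: contrapT => /forallNP run.
have {}run k : bp_active alpha t rmax (h k) by apply: contrapT => /negP; apply: run.
have hS k : h k.+1 = rcons (h k) (ord t rmax (h k)).
  by rewrite /h /= /bp_step -/(h k) run.
have r0 k : forall u, 0 <= (bp_after alpha t (h k)).2 u.
  elim: k => [|k IH] u; first by rewrite /= ler0n.
  by rewrite hS /bp_after foldl_rcons; apply: bp_push_ge0.
have PhiS k : Phi (bp_after alpha t (h k)) + (alpha * rmax) *+ k <=
              Phi (bp_init R t).
  elim: k => [|k IH]; first by rewrite mulr0n addr0.
  rewrite hS /bp_after foldl_rcons -/(bp_after _ _ _) bp_push_potential.
  apply: le_trans IH; rewrite mulrS addrA lerD2r.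
  have /ltW rv := ordP (run k).
  have d1 : 1 <= (deg (ord t rmax (h k)))%:R :> R by rewrite ler1n adj_gt0.
  have arv := ler_pM (ltW rmax_gt0) ler01 rv d1.
  case/andP: alpha01 => a0 _; move: arv; rewrite -(ler_pM2l a0); lra.
have ar0 : 0 < alpha * rmax by rewrite mulr_gt0 //; case/andP: alpha01.
have [m Hm] : exists m : nat, Phi (bp_init R t) < (alpha * rmax) *+ m.
  exists (Num.bound `|Phi (bp_init R t) / (alpha * rmax)|).
  rewrite -mulr_natl -ltr_pdivrMr //.
  by apply: le_lt_trans (ler_norm _) _; apply: archi_boundP; apply: normr_ge0.
have := PhiS m; rewrite leNgt => /negP; apply.
apply: lt_le_trans Hm _; rewrite lerDr /Phi; apply: sumr_ge0 => u _.
by rewrite mulr_ge0 // r0.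
Qed.

End Termination.

(* Main.v *)
Require Import Defs.
From mathcomp Require Import all_boot all_order all_algebra.
From mathcomp Require Import all_classical all_reals all_analysis.
From mathcomp Require Import measurable_realfun ring lra zify.
Import Order.TTheory GRing.Theory Num.Theory.
Local Open Scope ring_scope.

(** A push at [v] with threshold [r] lowers the potential [\sum_u r(u) d(u)],
    initially [d(t)], by at least [alpha r d(v)], so Backward Push for [t] costs
    [O(d(t) / r)].  Let [X = \sum_t pi'(s,t) d(t)].  Then attempt [i] of Phase II
    costs at most [1 + |C| + A 2^i], with [A] of order [X / (eps^2 n_r0)] and
    [|C| <= 2 / eps], and its budget is at most [B / 2^i], with [B] of order
    [n_t n_r0].  Whatever the stopping index is, the time spent is therefore
    bounded by the sum over [i] of the minima of the two, which is
    [O(log n / eps + sqrt (A B))] up to a factor [n_t]: for [i >= n_t] the budget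
    has dropped below [O(n_t / eps)], so no [log (1 / eps)] appears.  As
    [sqrt (A B)] is of order [sqrt X / eps] up to logarithms, as the expected cost
    of Phase III is twice the budget at the stopping index, and as [pi'] is an
    unbiased estimate of [pi], it remains to use [E sqrt X <= sqrt (E X)]; no
    concentration inequality is needed for the running time. *)

Set Implicit Arguments.
Unset Strict Implicit.
Unset Printing Implicit Defensive.

(** * Sums of minima of geometric sequences, rounding, logarithms *)

Section RealBounds.
Variable R : realType.
Implicit Types (A B a : R).

Lemma geometric_half_sum_le B m n : 0 <= B ->
  \sum_(m <= i < n) B / 2 ^+ i <= 2 * B / 2 ^+ m.
Proof.
move=> B0; have [nm|mn] := leqP n m.
  by rewrite big_geq // divr_ge0 ?exprn_ge0 ?mulr_ge0.
suff -> : \sum_(m <= i < n) B / 2 ^+ i = 2 * B / 2 ^+ m - 2 * B / 2 ^+ n.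
  by rewrite lerBlDr lerDl divr_ge0 ?exprn_ge0 ?mulr_ge0.
rewrite (eq_big_nat _ _ (F2 := fun i => (- (2 * B / 2 ^+ i.+1)) - (- (2 * B / 2 ^+ i)))).
  by rewrite telescope_sumr 1?ltnW // addrC opprK.
move=> i _; rewrite exprS invfM; set z := (2 ^+ i)^-1; lra.
Qed.

Lemma geometric_double_sum_le A n : 0 <= A ->
  \sum_(0 <= i < n) A * 2 ^+ i <= A * 2 ^+ n.
Proof.
move=> A0; elim: n => [|n IH]; first by rewrite big_geq // mulr_ge0 ?exprn_ge0.
rewrite big_nat_recr //= exprS; lra.
Qed.

(** A minimum is at most the geometric mean, and the product of the two terms is [A * B] for every
    [i]. *)
Lemma min_geometric_le_sqrt A B i : 0 <= A -> 0 <= B ->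
  Num.min (A * 2 ^+ i) (B / 2 ^+ i) <= Num.sqrt (A * B).
Proof.
move=> A0 B0.
have p0 : 0 < 2 ^+ i :> R by rewrite exprn_gt0.
set m := Num.min _ _.
have m1 : m <= A * 2 ^+ i by rewrite ge_min lexx.
have m2 : m <= B / 2 ^+ i by rewrite ge_min lexx orbT.
have m0 : 0 <= m by rewrite le_min mulr_ge0 ?divr_ge0 // ltW.
rewrite -[m]ger0_norm // -sqrtr_sqr ler_sqrt ?mulr_ge0 // expr2.
apply: le_trans (ler_pM m0 m0 m1 m2) _.
by rewrite le_eqVlt; apply/orP; left; apply/eqP; field; lra.
Qed.

(* Up to the crossing point of the two geometric sequences the sum is dominated
   by its last term, from there on by its first one; both terms are at most
   [sqrt (A * B)]. *)
Lemma sum_min_geometric A B n : 0 <= A -> 0 <= B ->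
  \sum_(0 <= i < n) Num.min (A * 2 ^+ i) (B / 2 ^+ i) <= 4 * Num.sqrt (A * B).
Proof.
move=> A0 B0; set S := Num.sqrt _.
have S0 : 0 <= S := sqrtr_ge0 _.
have p0 i : 0 < 2 ^+ i :> R by rewrite exprn_gt0.
have up j : (forall i, (i < j)%N -> A * 2 ^+ i <= B / 2 ^+ i) ->
    \sum_(0 <= i < j) Num.min (A * 2 ^+ i) (B / 2 ^+ i) <= 2 * S.
  move=> hj; apply: (@le_trans _ _ (\sum_(0 <= i < j) A * 2 ^+ i)).
    by apply: ler_sum => i _; rewrite ge_min lexx.
  case: j hj => [|j] hj; first by rewrite big_geq // mulr_ge0.
  apply: le_trans (geometric_double_sum_le _ A0) _.
  have := min_geometric_le_sqrt j A0 B0; rewrite min_l ?hj // exprS -/S; lra.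
(* [j] is the crossing point, capped at [n] because for [A = 0 < B] the sequences never cross. *)
have [j Bj hj] : exists2 j, (B / 2 ^+ j <= A * 2 ^+ j) || (n <= j)%N &
    forall i, (i < j)%N -> A * 2 ^+ i <= B / 2 ^+ i.
  have ex : exists j, (B / 2 ^+ j <= A * 2 ^+ j) || (n <= j)%N.
    by exists n; rewrite leqnn orbT.
  case: (ex_minnP ex) => j hj jmin; exists j => // i ij; rewrite leNgt.
  by apply/negP => /ltW h; have := jmin i; rewrite h (leqNgt j) ij => /(_ isT).
have [nj|jn] := leqP n j.
  apply: le_trans (up n _) _; last by lra.
  by move=> i ij; apply: hj; apply: leq_trans nj.
rewrite leqNgt jn orbF in Bj.
rewrite (@big_cat_nat _ _ _ j 0 n) ?(ltnW jn) //=.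
have lo : \sum_(j <= i < n) Num.min (A * 2 ^+ i) (B / 2 ^+ i) <= 2 * B / 2 ^+ j.
  apply: le_trans (geometric_half_sum_le j n B0).
  by apply: ler_sum => i _; rewrite ge_min lexx orbT.
have := min_geometric_le_sqrt j A0 B0; rewrite min_r // -/S.
have := up j hj; lra.
Qed.

(** The cut [m] is free: before it each term is bounded by [a], from it on by the geometric tail. It
    will be [n_t]. *)
Lemma sum_min_cst_geometric a B m n : 0 <= a -> 0 <= B ->
  \sum_(0 <= i < n) Num.min a (B / 2 ^+ i) <= m%:R * a + 2 * B / 2 ^+ m.
Proof.
move=> a0 B0.
have b0 i : 0 <= B / 2 ^+ i by rewrite divr_ge0 ?exprn_ge0.
apply: (@le_trans _ _ (\sum_(0 <= i < m) a + \sum_(m <= i < n) B / 2 ^+ i)); last first.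
  rewrite lerD ?geometric_half_sum_le // sumr_const_nat subn0 mulr_natl //.
have [nm|/ltnW mn] := leqP n m.
  rewrite [X in _ + X]big_geq // addr0 (@big_cat_nat _ _ _ n 0 m) //=.
  rewrite -[leLHS]addr0 lerD ?sumr_ge0 //.
  by apply: ler_sum => i _; rewrite ge_min lexx.
rewrite (@big_cat_nat _ _ _ m) //= lerD //.
  by apply: ler_sum => i _; rewrite ge_min lexx.
by apply: ler_sum => i _; rewrite ge_min lexx orbT.
Qed.

Lemma nceil_ge (x : R) : x <= (nceil x)%:R.
Proof.
apply: le_trans (Num.Theory.ceil_ge x) _; rewrite /nceil -[X in X <= _]/(_%:~R).
rewrite -[X in _ <= X]/((Posz `|Num.ceil x|%N)%:~R) ler_int abszE; exact: ler_norm.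
Qed.

Lemma nceil_le (x : R) : 0 <= x -> (nceil x)%:R <= x + 1.
Proof.
move=> x0; rewrite /nceil -[leLHS]/((Posz `|Num.ceil x|%N)%:~R) abszE ger0_norm.
  by have := Num.Theory.ceilB1_lt x; rewrite intrB => h; lra.
by rewrite -(ler_int R); apply: le_trans x0 (Num.Theory.ceil_ge x).
Qed.

(** This is [ln (1 + x) <= x] at [x = - 1 / 2]. *)
Lemma ln2_ge_half : 1 / 2 <= @ln R 2.
Proof.
have := @le_ln1Dx R (- (1 / 2)); rewrite (_ : 1 + - (1 / 2) = 2^-1); last by lra.
by rewrite lnV ?posrE // => /(_ _); rewrite lerN2; apply; lra.
Qed.

End RealBounds.

(** * Cost of one run of Backward Push *)

Section BackwardPushCost.
Variables (R : realType) (alpha : R) (G : ugraph).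
Hypothesis alpha01 : 0 < alpha < 1.

Lemma bp_after_ge0 (t : G) h u : 0 <= (bp_after alpha t h).2 u.
Proof.
elim/last_ind: h u => [|h v IH] u; first by rewrite /= ler0n.
by rewrite /bp_after foldl_rcons; exact: bp_push_ge0.
Qed.

Variables (ord : push_order R G) (ordP : valid_order alpha ord).

(* Every push at [v] removes at least [alpha * rmax * deg v] from the potential
   [\sum_u r u * deg u], whose initial value is [deg t]. *)
Lemma bp_run_degree_le (t : G) (rmax : R) :
  alpha * rmax * (\sum_(v <- bp_run alpha ord t rmax) deg v)%:R <= (deg t)%:R.
Proof.
have a0 : 0 < alpha by case/andP: alpha01.
pose Phi h := \sum_u (bp_after alpha t h).2 u * (deg u)%:R.
have Phi0 h : 0 <= Phi h by apply: sumr_ge0 => u _; rewrite mulr_ge0 ?bp_after_ge0.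
(* The invariant is proved after any number of steps, so the number chosen by [xget] in [bp_run]
   does not matter. *)
suff H k : Phi (iter k (bp_step alpha ord t rmax) [::]) + alpha * rmax *
    (\sum_(v <- iter k (bp_step alpha ord t rmax) [::]) deg v)%:R <= (deg t)%:R.
  by rewrite /bp_run; set k := xget _ _; move: (H k); apply: le_trans; rewrite lerDr Phi0.
elim: k => [|k] /=.
  rewrite big_nil mulr0 addr0 /Phi /bp_after /= (bigD1 t) //= eqxx mul1r.
  by rewrite big1 ?addr0 // => u /negbTE->; rewrite mul0r.
set h := iter _ _ _ => IH; rewrite /bp_step; case: ifP => // act.
rewrite big_rcons /= /Phi /bp_after foldl_rcons -/(bp_after _ _ _).
rewrite bp_push_potential -/(Phi h); apply: le_trans IH.
have /ltW rv := ordP act.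
rewrite natrD.
have : alpha * rmax * (deg (ord t rmax h))%:R <=
  alpha * (bp_after alpha t h).2 (ord t rmax h) * (deg (ord t rmax h))%:R.
  by rewrite ler_wpM2r // ler_pM2l.
lra.
Qed.

(** A push costs [1 + deg v <= 2 * deg v], as no vertex is isolated. By the symmetry of PPR, [deg t]
    is the sum of [pi(v, t) * deg v] over [v] that appears in the usual cost bound. *)
Lemma bp_cost_le (t : G) (rmax : R) : 0 < rmax ->
  (bp_cost alpha ord t rmax)%:R <= 1 + 2 * (deg t)%:R / (alpha * rmax).
Proof.
move=> r0; have a0 : 0 < alpha by case/andP: alpha01.
rewrite /bp_cost natrD lerD2l ler_pdivlMr ?mulr_gt0 //.
apply: le_trans (_ : 2 * (\sum_(v <- bp_run alpha ord t rmax) deg v)%:R * (alpha * rmax) <= _).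
  rewrite ler_wpM2r //; first by rewrite mulr_ge0 // ltW.
  rewrite -natrM ler_nat big_distrr /=.
  by apply: leq_sum => v _; have := adj_gt0 v; rewrite -/(deg v); lia.
rewrite -mulrA ler_pM2l // mulrC; exact: bp_run_degree_le.
Qed.

(** A push at [v] can create nonzero residues only at neighbours of [v]. This lets the evaluation of
    the estimates in Phase III be charged to the pushes. *)
Lemma bp_support_le (t : G) h :
  (#|[pred v | (bp_after alpha t h).2 v != 0%R]| <= 1 + \sum_(v <- h) deg v)%N.
Proof.
elim/last_ind: h => [|h v IH].
  rewrite big_nil addn0 -(card1 t); apply: subset_leq_card.
  by apply/fintype.subsetP => u; rewrite !inE /=; case: (u == t) => //; rewrite eqxx.
rewrite big_rcons /= addnA.
apply: leq_trans (leq_add IH (leqnn (deg v))).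
apply: leq_trans
  (_ : #|[predU [pred v | (bp_after alpha t h).2 v != 0%R] & adj v]| <= _)%N; last first.
  by rewrite -cardUI leq_addr.
apply: subset_leq_card; apply/fintype.subsetP => u; rewrite !inE /bp_after foldl_rcons.
rewrite -/(bp_after _ _ _) /=; case: (bp_after alpha t h) => q r /=.
case: ifP => _; first by rewrite eqxx.
by rewrite -[u \in adj v]/(adj v u); case: (adj v u) => [_|->]; rewrite ?orbT.
Qed.

Lemma bp_residue_support_le (t : G) (rmax : R) :
  (#|[pred v | bp_residue alpha ord t rmax v != 0%R]| <= bp_cost alpha ord t rmax)%N.
Proof.
apply: leq_trans (bp_support_le _ _) _; rewrite leq_add2l.
by apply: leq_sum => v _; exact: leq_addl.
Qed.

End BackwardPushCost.

Lemma deg_gt0 (G : ugraph) (v : G) : (0 < deg v)%N.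
Proof. exact: adj_gt0. Qed.

(** A neighbour of [s] differs from [s]. Hence [ln #|G|] is bounded away from 0 and can absorb
    additive constants. *)
Lemma card_ugraph_gt1 (G : ugraph) (s : G) : (1 < #|G|)%N.
Proof.
have /card_gt0P[v sv] := adj_gt0 s.
rewrite (cardD1 s) (cardD1 v) !inE andbT.
case: eqVneq sv => [->|_ _]; last by rewrite /= !add1n.
by rewrite -[s \in adj s]/(adj s s) adj_irr.
Qed.

(** * Sizes of the samples in terms of [ln #|G|] and [eps] *)

Section SampleSizes.
Variables (R : realType) (G : ugraph) (s : G).

Local Notation lnn := (@ln R #|G|%:R).

Let n2 : 2 <= #|G|%:R :> R.
Proof. by rewrite ler_nat; exact: card_ugraph_gt1 s. Qed.

Lemma ln_card_ge_half : 1 / 2 <= lnn.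
Proof. by apply: le_trans (ln2_ge_half R) _; have h := n2; rewrite ler_ln ?posrE //; lra. Qed.

Let ln_poly k : @ln R (2 * #|G|%:R ^+ k) = ln 2 + lnn *+ k.
Proof. by have h := n2; rewrite lnM ?lnXn ?posrE ?exprn_gt0 //; lra. Qed.

Let ln2_le : @ln R 2 <= lnn.
Proof. by have h := n2; rewrite ler_ln ?posrE //; lra. Qed.

Lemma n_t_ge1 : 1 <= (n_t R G)%:R :> R.
Proof.
apply: le_trans (nceil_ge _); rewrite ln_poly mulr2n.
have := ln2_le; have := ln_card_ge_half; have := ln2_ge_half R; lra.
Qed.

(** With [ln 2 <= lnn] the logarithm is at most [3 * lnn], which gives 54; rounding up adds
    [1 <= 2 * lnn]. *)
Lemma n_t_le : (n_t R G)%:R <= 56 * lnn.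
Proof.
apply: le_trans (nceil_le _) _; rewrite ln_poly mulr2n;
have := ln2_le; have := ln_card_ge_half; have := ln2_ge_half R; lra.
Qed.

Lemma n_first_le (eps : R) : 0 < eps <= 1 ->
  (n_first G eps)%:R <= 50 * lnn / eps.
Proof.
case/andP=> e0 e1; have H0 := ln2_le; have H := ln_card_ge_half; have H2 := ln2_ge_half R.
have ie : 1 <= eps^-1 by rewrite invf_ge1.
apply: le_trans (nceil_le _) _; rewrite ln_poly -mulr_natr.
  by rewrite divr_ge0 ?(ltW e0) // mulr_ge0 //; lra.
set z := eps^-1 in ie *; nra.
Qed.

(** [n_t] halvings remove the factor [#|G|] from [n_r0]. The reason is [n_t * ln 2 >= n_t / 2 >= 9 *
    ln (2 * #|G| ^ 2)]. *)
Lemma card_le_exp2_n_t : #|G|%:R <= 2 ^+ n_t R G :> R.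
Proof.
have n0 : 0 < #|G|%:R :> R by have := n2; lra.
rewrite -ler_ln ?posrE ?exprn_gt0 // lnXn // -(mulr_natr (ln 2)).
have := nceil_ge (18 * @ln R (2 * #|G|%:R ^+ 2)); rewrite -/(n_t R G) ln_poly mulr2n.
have := ln2_le; have := ln_card_ge_half; have := ln2_ge_half R; have := n_t_ge1.
set N := (n_t R G)%:R; set a := ln 2; set b := lnn => N1 ab ba b2 hN.
have := mulr_ge0 (_ : 0 <= a - 1 / 2) (_ : 0 <= N); rewrite mulrBl => /(_ _ _) aN.
have : 0 <= a * N - 1 / 2 * N by apply: aN; lra.
lra.
Qed.

Variable eps : R.
Hypothesis eps01 : 0 < eps <= 1.

Lemma n_r0_ge : #|G|%:R / eps <= (n_r0 G eps)%:R.
Proof. exact: nceil_ge. Qed.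

Lemma n_r0_le : (n_r0 G eps)%:R <= 2 * #|G|%:R / eps.
Proof.
case/andP: eps01 => e0 e1; have ie : 1 <= eps^-1 by rewrite invf_ge1.
apply: le_trans (nceil_le _) _.
  by have h := n2; rewrite divr_ge0 ?(ltW e0) //; lra.
have := n2; set z := eps^-1 in ie *; nra.
Qed.

Lemma n_r_le i : (n_r G eps i)%:R <= (n_r0 G eps)%:R / 2 ^+ i :> R.
Proof.
rewrite ler_pdivlMr ?exprn_gt0 // -natrX -natrM ler_nat /n_r.
elim: i => [|i IH] /=; first by rewrite muln1.
apply: leq_trans IH; rewrite expnS mulnA leq_mul2r; apply/orP; right.
by have := odd_double_half (iter i half (n_r0 G eps)); lia.
Qed.

End SampleSizes.

(** * Cost of Phases II and III for fixed estimates [pi1] of total mass at most 1 *)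

Section PhaseTwoCost.
Variables (R : realType) (alpha : R) (G : ugraph).
Variables (ord : push_order R G) (s : G) (eps : R) (pi1 : G -> R).
Hypotheses (alpha01 : 0 < alpha < 1) (ordP : valid_order alpha ord).
Hypothesis eps01 : 0 < eps <= 1.
Hypotheses (pi1_ge0 : forall t, 0 <= pi1 t) (pi1_le1 : \sum_t pi1 t <= 1).
Hypothesis mwc_range : 1 <= mean_walk_cost alpha s <= alpha^-1.

Let a0 : 0 < alpha. Proof. by case/andP: alpha01. Qed.
Let a1 : alpha < 1. Proof. by case/andP: alpha01. Qed.
Let e0 : 0 < eps. Proof. by case/andP: eps01. Qed.
Let e1 : eps <= 1. Proof. by case/andP: eps01. Qed.

Local Notation C := (candidates eps pi1).
Local Notation N := (n_t R G)%:R.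
Local Notation nr0 := (n_r0 G eps)%:R.
Local Notation M := (mean_walk_cost alpha s).
Local Notation X := (\sum_t pi1 t * (deg t)%:R).
Local Notation bud := (budget alpha s eps).
Local Notation try := (try_cost alpha ord eps pi1).
Local Notation K := (stop_index alpha ord s eps pi1).
Local Notation Q := (N / (alpha * eps)).

Let X0 : 0 <= X. Proof. by apply: sumr_ge0 => t _; rewrite mulr_ge0. Qed.

Let nr0_gt0 : 0 < nr0 :> R.
Proof.
have := n_r0_ge G eps; apply: lt_le_trans; rewrite divr_gt0 // ltr0n.
by rewrite ltnW // (card_ugraph_gt1 s).
Qed.

(** Each candidate carries more than [eps / 2] of a total mass of at most 1. *)
Lemma card_candidates_le : #|C|%:R <= 2 / eps :> R.
Proof.
rewrite ler_pdivlMr //; suff : #|C|%:R * (eps / 2) <= 1 by lra.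
apply: le_trans pi1_le1; rewrite mulr_natl -sumr_const.
apply: le_trans (_ : \sum_(t in C) pi1 t <= _).
  by apply: ler_sum => t; rewrite inE => /ltW.
by rewrite [leRHS](bigID (mem C)) /= lerDl sumr_ge0.
Qed.

(** The threshold is inversely proportional to [pi1 t], so [bp_cost_le] weights [deg t] by [pi1 t].
    The attempts have [c = 2], the final pushes [c = 1]. *)
Lemma sum_bp_cost_le i (c : R) : 0 < c ->
  (\sum_(t in C) bp_cost alpha ord t (r_max eps pi1 i t / c))%:R <=
  #|C|%:R + 12 * c * X / (alpha * eps ^+ 2 * nr0) * 2 ^+ i.
Proof.
move=> c0; rewrite natr_sum.
have p0 : 0 < 2 ^+ i :> R by rewrite exprn_gt0.
have H t : t \in C -> (bp_cost alpha ord t (r_max eps pi1 i t / c))%:R <=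
    1 + 12 * c / (alpha * eps ^+ 2 * nr0) * 2 ^+ i * (pi1 t * (deg t)%:R).
  rewrite inE => tC; have t0 : 0 < pi1 t by apply: lt_trans _ tC; rewrite divr_gt0.
  have r0 : 0 < r_max eps pi1 i t / c.
    by rewrite /r_max !divr_gt0 ?mulr_gt0 ?exprn_gt0.
  apply: le_trans (bp_cost_le alpha01 ordP _ r0) _.
  rewrite lerD2l le_eqVlt; apply/orP; left; apply/eqP.
  rewrite /r_max; field.
  by rewrite !gt_eqF.
apply: le_trans (ler_sum _ H) _.
rewrite big_split /= sumr_const lerD2l -mulr_sumr.
rewrite [leRHS](_ : _ = 12 * c / (alpha * eps ^+ 2 * nr0) * 2 ^+ i * X); last first.
  by rewrite -!mulrA; congr (_ * _); congr (_ * _); rewrite mulrC !mulrA; congr (_ * _).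
apply: ler_wpM2l.
  by rewrite mulr_ge0 ?divr_ge0 ?mulr_ge0 ?exprn_ge0 // ltW.
by rewrite [leRHS](bigID (mem C)) /= lerDl sumr_ge0 // => t _; rewrite mulr_ge0.
Qed.

Let A := 24 * X / (alpha * eps ^+ 2 * nr0).
Let B := N * nr0 / 2 * M.

Let A0 : 0 <= A.
Proof. by rewrite divr_ge0 ?mulr_ge0 ?exprn_ge0 // ltW. Qed.

Let M0 : 0 <= M. Proof. by case/andP: mwc_range => h _; lra. Qed.

Let B0 : 0 <= B.
Proof. by rewrite !mulr_ge0. Qed.

Lemma try_cost_le i : (try i)%:R <= 1 + #|C|%:R + A * 2 ^+ i.
Proof.
rewrite natrD -addrA lerD2l; apply: le_trans (sum_bp_cost_le i (ltr0n _ 2)) _.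
by rewrite lerD2l (_ : 12 * 2%:R = 24) // -natrM.
Qed.

Lemma budget_le i : bud i <= B / 2 ^+ i.
Proof.
rewrite /budget /B (_ : N * nr0 / 2 * M / 2 ^+ i = N * (nr0 / 2 ^+ i) / 2 * M); last by ring.
rewrite ler_wpM2r // ler_wpM2r ?invr_ge0 // ler_wpM2l //; exact: n_r_le.
Qed.

Lemma budget_ge0 i : 0 <= bud i.
Proof. by rewrite !mulr_ge0. Qed.

(** What attempt [i] spends, up to the rounding of the budget; it makes sense for all [i], also
    beyond the stopping index. *)
Local Notation used i := (Num.min (try i)%:R (bud i)).

(** For nonnegative reals [min (a + b) c <= min a c + min b c]. This separates the fixed part of an
    attempt from the part that doubles. *)
Lemma used_le i :
  used i <= Num.min (1 + #|C|%:R) (B / 2 ^+ i) + Num.min (A * 2 ^+ i) (B / 2 ^+ i).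
Proof.
have := try_cost_le i; have := budget_le i.
have : 0 <= 1 + #|C|%:R :> R by rewrite addr_ge0.
have : 0 <= A * 2 ^+ i by rewrite mulr_ge0 ?exprn_ge0.
have : 0 <= B / 2 ^+ i by rewrite divr_ge0 ?exprn_ge0.
move: (1 + _) (A * _) (B / _) (bud i) (try i)%:R => a b c x y.
rewrite /Num.min; do 3 case: ifP; move=> *; lra.
Qed.

(** The fixed parts give 3 before index [n_t] and 2 from it on; the doubling parts give 4 times
    [4 * sqrt X]. The bound is uniform in [n], so the stopping index need not be located. *)
Lemma sum_used_le n : \sum_(0 <= i < n) used i <= Q * (5 + 16 * Num.sqrt X).
Proof.
apply: le_trans (ler_sum _ (fun i _ => used_le i)) _; rewrite big_split /=.
have a0' : 0 <= 1 + #|C|%:R :> R by rewrite addr_ge0.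
apply: le_trans (lerD (sum_min_cst_geometric (n_t R G) n a0' B0)
  (sum_min_geometric n A0 B0)) _.
have N1 := n_t_ge1 R s.
have aQ : N * (1 + #|C|%:R) <= 3 * Q.
  rewrite mulrCA ler_wpM2l //.
  apply: le_trans (_ : 3 / eps <= _).
    have : 1 <= eps^-1 by rewrite invf_ge1.
    have := card_candidates_le; lra.
  rewrite ler_pM2l // lef_pV2 ?posrE ?mulr_gt0 //.
  by rewrite ger_pMl // ltW.
have BQ : B <= Q * #|G|%:R.
  rewrite /B (_ : Q * #|G|%:R = N * (2 * #|G|%:R / eps) / 2 * alpha^-1); last first.
    by field; rewrite !gt_eqF.
  apply: ler_pM => //; last by case/andP: mwc_range.
  by rewrite ler_wpM2r ?invr_ge0 // ler_wpM2l // n_r0_le.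
have BN : 2 * B / 2 ^+ n_t R G <= 2 * Q.
  rewrite ler_pdivrMr ?exprn_gt0 // -mulrA ler_pM2l //.
  apply: le_trans BQ _; rewrite ler_wpM2l ?card_le_exp2_n_t //.
  by rewrite divr_ge0 // mulr_ge0 // ltW.
(* [n_r0] cancels in [A * B]. What remains is [12 * N * M * X / (alpha * eps ^+ 2)], to be combined
   with [M <= 1 / alpha] and [1 <= N]. *)
have sAB : Num.sqrt (A * B) <= 4 * Q * Num.sqrt X.
  have Q0 : 0 <= 4 * Q by rewrite mulr_ge0 // divr_ge0 // mulr_ge0 // ltW.
  rewrite -[4 * Q]ger0_norm // -sqrtr_sqr -sqrtrM ?sqr_ge0 // ler_sqrt; last first.
    by rewrite mulr_ge0 ?sqr_ge0.
  rewrite (_ : A * B = (N / (alpha * eps ^+ 2) * X) * (12 * M)); last first.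
    by rewrite /A /B; field; rewrite !gt_eqF.
  rewrite (_ : (4 * Q) ^+ 2 * X = (N / (alpha * eps ^+ 2) * X) * (16 * N * alpha^-1)); last first.
    by field; rewrite !gt_eqF.
  apply: ler_wpM2l.
    by rewrite mulr_ge0 // divr_ge0 // mulr_ge0 ?exprn_ge0 // ltW.
  case/andP: mwc_range => _ Ma.
  have : 0 < alpha^-1 by rewrite invr_gt0.
  nra.
rewrite -[leRHS]/(Q * (5 + 16 * Num.sqrt X)); lra.
Qed.

Lemma used_le_sum i n : (i < n)%N -> used i <= \sum_(0 <= j < n) used j.
Proof.
move=> lt_in; have u0 j : 0 <= used j by rewrite le_min ler0n budget_ge0.
by rewrite big_mkord (bigD1 (Ordinal lt_in)) //= lerDl sumr_ge0.
Qed.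

Lemma used_before_stop i : (i < K)%N -> used i = (try i)%:R.
Proof.
move=> iK; rewrite min_l // leNgt; apply/negP => ti; move: iK; rewrite ltnNge.
by rewrite /stop_index; case: ex_minnP => j _ /(_ i ti) ->.
Qed.

(** The stopping attempt exceeds its budget. Hence the budget at [K], which governs Phase III, is
    itself a summand in [sum_used_le]. *)
Lemma used_at_stop : used K = bud K.
Proof.
by rewrite min_r // ltW // /stop_index; case: ex_minnP.
Qed.

Let Q_ge1 : 1 <= Q.
Proof.
rewrite ler_pdivlMr ?mulr_gt0 // mul1r.
apply: le_trans (n_t_ge1 R s); rewrite -[leRHS]mulr1 ler_pM // ltW //.
Qed.

(** Only the interrupted attempt can spend more than [used], by at most one unit, which [1 <= Q]
    absorbs. *)
Lemma sum_try_spent_le :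
  (\sum_(0 <= i < K.+1) try_spent alpha ord s eps pi1 i)%:R <=
  Q * (6 + 16 * Num.sqrt X).
Proof.
apply: le_trans (_ : \sum_(0 <= i < K.+1) used i + 1 <= _); last first.
  by have := sum_used_le K.+1; have := Q_ge1; lra.
rewrite natr_sum !big_nat_recr //= -addrA lerD //; last first.
  rewrite used_at_stop /try_spent; apply: (@le_trans _ _ (Num.truncn (bud K)).+1%:R).
    by rewrite ler_nat geq_minr.
  by rewrite -natr1 lerD2r truncn_le ?budget_ge0.
rewrite !big_nat; apply: ler_sum => i iK.
by rewrite used_before_stop // ler_nat geq_minl.
Qed.

(** If [K = k + 1], the final thresholds are those of attempt [k], which stayed within its budget
    and is counted in [used k]. If [K = 0], no attempt was completed, and [X <= #|G| <= eps * n_r0]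
    suffices. *)
Lemma final_push_cost_le :
  (\sum_(t in C) bp_cost alpha ord t (r_max eps pi1 K t))%:R <=
  Q * (19 + 16 * Num.sqrt X).
Proof.
have s0 := sqrtr_ge0 X.
case EK : K => [|k].
  have := sum_bp_cost_le 0 ltr01.
  under eq_bigr do rewrite divr1.
  move/le_trans; apply; rewrite expr0 !mulr1.
  have XG : X <= #|G|%:R.
    apply: le_trans (_ : \sum_t pi1 t * #|G|%:R <= _).
      by apply: ler_sum => t _; rewrite ler_wpM2l // ler_nat max_card.
    by rewrite -mulr_suml ger_pMl // ltr0n ltnW // (card_ugraph_gt1 s).
  have h : 12 * X / (alpha * eps ^+ 2 * nr0) <= 12 / (alpha * eps).
    rewrite ler_pdivrMr ?mulr_gt0 ?exprn_gt0 //.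
    rewrite (_ : 12 / (alpha * eps) * (alpha * eps ^+ 2 * nr0) = 12 * (eps * nr0)); last first.
      by field; rewrite !gt_eqF.
    rewrite ler_pM2l //; apply: le_trans XG _.
    by rewrite mulrC -ler_pdivrMr // n_r0_ge.
  have cC := card_candidates_le.
  have ae : eps^-1 <= (alpha * eps)^-1.
    by rewrite lef_pV2 ?posrE ?mulr_gt0 // ger_pMl // ltW.
  have NQ : (alpha * eps)^-1 <= Q.
    by rewrite -[leLHS]mul1r ler_wpM2r ?n_t_ge1 // invr_ge0 mulr_ge0 // ltW.
  have := mulr_ge0 (le_trans ler01 Q_ge1) s0; move: Q_ge1 h cC ae NQ.
  set q := Q; set y := _ / (_ * nr0); set S := Num.sqrt _; set c := #|C|%:R.
  by set z := (alpha * eps)^-1; set w := eps^-1; lra.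
apply: le_trans (_ : Q * (5 + 16 * Num.sqrt X) <= _); last first.
  by rewrite ler_wpM2l ?(le_trans ler01 Q_ge1) //; lra.
apply: le_trans (sum_used_le k.+1); apply: le_trans (used_le_sum (ltnSn k)).
rewrite used_before_stop ?EK // ler_nat /try_cost.
apply: leq_trans (leq_addl _ _); apply: leq_sum => t _.
rewrite (_ : r_max eps pi1 k.+1 t = r_max eps pi1 k t / 2) //.
by rewrite /r_max (exprSr 2) -[in RHS]mulrA -(invfM (2 ^+ k) 2).
Qed.

(* The last summand is the expected cost of the walks of Phase III. *)
Lemma cost_given_estimates_le :
  (phase2_cost alpha ord s eps pi1)%:R
  + (\sum_(0 <= i < n_t R G) \sum_(t in C)
      (1 + #|[pred v | bp_residue alpha ord t (r_max eps pi1 K t) v != 0%R]|))%:R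
  + (\sum_(t in C) n_t R G)%:R
  + (n_t R G * n_r G eps K)%:R / alpha
  <= 80 * N ^+ 2 / (alpha ^+ 2 * eps) * (1 + Num.sqrt X).
Proof.
have N1 := n_t_ge1 R s.
have fin := final_push_cost_le; have spent := sum_try_spent_le.
rewrite /phase2_cost natrD; set F := (\sum_(t in C) bp_cost _ _ _ _)%:R in fin *.
set T := (\sum_(0 <= i < _) _)%:R in spent *.
set S := Num.sqrt X in fin spent *; have S0 : 0 <= S := sqrtr_ge0 X.
have cC := card_candidates_le.
have ia : 1 <= alpha^-1 by rewrite invf_ge1 // ltW.
have eQ : N * eps^-1 <= Q by rewrite ler_wpM2l // lef_pV2 ?posrE ?mulr_gt0 // ger_pMl // ltW.
(* The nonzero residues of a target are at most as many as the units spent on its final push. *)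
have h2 : (\sum_(0 <= i < n_t R G) \sum_(t in C)
    (1 + #|[pred v | bp_residue alpha ord t (r_max eps pi1 K t) v != 0%R]|))%:R <=
    N * (#|C|%:R + F).
  rewrite sum_nat_const_nat subn0 natrM ler_wpM2l // -natrD ler_nat big_split /=.
  rewrite sum1_card leq_add2l; apply: leq_sum => t _; exact: bp_residue_support_le.
have h3 : (\sum_(t in C) n_t R G)%:R = #|C|%:R * N :> R by rewrite sum_nat_const natrM.
(* The number of walks is twice the budget at [K] divided by [M >= 1]. *)
have h4 : (n_t R G * n_r G eps K)%:R / alpha <= 2 / alpha * (Q * (5 + 16 * S)).
  rewrite mulrAC ler_wpM2r ?invr_ge0 ?(ltW a0) //.
  rewrite mulrC -ler_pdivrMr //.
  apply: le_trans (sum_used_le K.+1); apply: le_trans (used_le_sum (ltnSn K)).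
  rewrite used_at_stop /budget natrM mulrC -[leLHS]mulr1.
  by rewrite ler_wpM2l ?mulr_ge0 //; case/andP: mwc_range.
rewrite h3.
(* All terms are measured in [N * Q / alpha]: the coefficients of [S] add up to 16 + 16 + 16 + 32 =
   80, the constants only to 58. *)
rewrite (_ : 80 * N ^+ 2 / (alpha ^+ 2 * eps) = 80 * (N * Q * alpha^-1)); last first.
  by field; rewrite !gt_eqF.
have Q0 := le_trans ler01 Q_ge1.
have QN : Q <= N * Q * alpha^-1.
  by rewrite -[leLHS]mulr1 ler_pM // -[leLHS]mul1r ler_wpM2r //.
have NC : N * #|C|%:R <= 2 * Q.
  by apply: le_trans (ler_wpM2l _ cC) _ => //; lra.
have NF : N * F <= N * Q * alpha^-1 * (19 + 16 * S).
  apply: le_trans (ler_wpM2l _ fin) _ => //.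
  rewrite (mulrA N Q) ler_wpM2r //; first by lra.
  by rewrite -[leLHS]mulr1 ler_wpM2l // mulr_ge0.
have h5 : 2 / alpha * (Q * (5 + 16 * S)) <= N * Q * alpha^-1 * (10 + 32 * S).
  rewrite (_ : _ * _ = Q * alpha^-1 * (10 + 32 * S)); last by ring.
  rewrite ler_wpM2r //; first by lra.
  by rewrite ler_wpM2r ?invr_ge0 ?(ltW a0) // -[leLHS]mul1r ler_wpM2r //.
have QS := ler_wpM2r S0 QN.
have QS0 := mulr_ge0 Q0 S0.
set W := N * Q * alpha^-1 in QN NF h5 QS *.
rewrite mulrDr in h2; nra.
Qed.

End PhaseTwoCost.

Local Open Scope classical_set_scope.

(** * Laws of finite and countable random elements *)

Lemma esum_finType (R : realType) (I : finType) (A : pred I) (a : I -> \bar R) :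
  (forall i, 0 <= a i)%E ->
  (\esum_(i in [set i | A i]) a i = \sum_(i | A i) a i)%E.
Proof.
move=> a0; rewrite esum_fset //; last exact: finite_finset.
rewrite (bigfs _ (index_enum_uniq I)) // => i _; rewrite mem_index_enum //.
Qed.

Section CountableRandomElement.
Variables (R : realType) (d : measure_display) (Omega : measurableType d).
Variables (P : {measure set Omega -> \bar R}) (T : countType) (Y : Omega -> T).
Hypothesis mY : forall w, measurable (Y @^-1` [set w]).

Lemma countable_preimage_measurable (A : set T) : measurable (Y @^-1` A).
Proof.
have -> : Y @^-1` A = \bigcup_(w in A) Y @^-1` [set w].
  by apply/seteqP; split => [x Ax|x [w Aw /= ->//]]; exists (Y x).
rewrite bigcup_mkcond; apply: countable_bigcupT_measurable => // w.
by case: ifP.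
Qed.

Lemma countable_comp_measurable (d' : measure_display) (U : measurableType d')
  (f : T -> U) : measurable_fun setT (f \o Y).
Proof.
by move=> _ B _; rewrite setTI comp_preimage; exact: countable_preimage_measurable.
Qed.

(** [pickle] arranges the fibres of [Y] in a sequence, to which countable additivity applies. *)
Lemma measure_preimage_esum (A : set T) :
  (P (Y @^-1` A) = \esum_(w in A) P (Y @^-1` [set w]))%E.
Proof.
pose F n := [set x | pickle (Y x) = n].
have FE w : F (pickle w) = Y @^-1` [set w].
  by apply/seteqP; split => [x /= /(pcan_inj pickleK)|x /= Yx]; rewrite /F /= ?Yx.
have mF n : measurable (F n) := countable_preimage_measurable [set w | pickle w = n].
have -> : Y @^-1` A = \bigcup_(n in pickle @` A) F n.
  apply/seteqP; split => [x Ax|x [n [w Aw <-]]]; last by rewrite FE /= => ->.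
  by exists (pickle (Y x)) => //; exists (Y x).
rewrite measure_bigcup //; last by move=> i j _ _ [x [/= <- <-]].
rewrite nneseries_esum // set_mem_set esum_image //; last first.
  by move=> x y _ _ /(pcan_inj pickleK).
by apply: eq_esum => w _; rewrite FE.
Qed.

End CountableRandomElement.

Lemma measure_preimage_sum (R : realType) (d : measure_display)
    (Omega : measurableType d) (P : {measure set Omega -> \bar R})
    (I : finType) (Y : Omega -> I) (A : pred I) :
  (forall i, measurable (Y @^-1` [set i])) ->
  (P [set x | A (Y x)] = \sum_(i | A i) P (Y @^-1` [set i]))%E.
Proof. by move=> mY; rewrite -esum_finType // -measure_preimage_esum. Qed.

(** * The length of a discounted walk is geometric *)

Section WalkLaw.
Variables (R : realType) (alpha : R) (G : ugraph).
Hypothesis alpha01 : 0 < alpha < 1.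

Lemma walk_prob_ge0 (s : G) w : 0 <= walk_prob alpha s w.
Proof.
case/andP: alpha01 => a0 a1; rewrite /walk_prob; case: ifP => // _.
by rewrite mulr_ge0 ?(ltW a0) // prodr_ge0 // => v _; rewrite divr_ge0 // subr_ge0 ltW.
Qed.

Lemma walk_prob_cons (s v : G) w : walk_prob alpha s (v :: w) =
  if adj s v then (1 - alpha) / (deg s)%:R * walk_prob alpha v w else 0.
Proof.
rewrite /walk_prob /=; case: (adj s v) => //=; case: ifP => _; last by rewrite mulr0.
by rewrite big_cons mulrA.
Qed.

(** Induction on the first step: summing over the [deg s] neighbours cancels the division by
    [deg s], so each step contributes a factor [1 - alpha]. *)
Lemma walk_mass_size k (s : G) :
  \sum_(w : k.-tuple G) walk_prob alpha s w = alpha * (1 - alpha) ^+ k.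
Proof.
elim: k s => [|k IH] s.
  rewrite (bigD1 [tuple]) //= big1 => [|w]; last by rewrite (tuple0 w) => /negP[].
  by rewrite /walk_prob /= big_nil mul1r mulr1 addr0.
rewrite (reindex (fun p : G * k.-tuple G => cons_tuple p.1 p.2)) /=; last first.
  exists (fun w => (thead w, behead_tuple w)) => [[v w] _|w _] /=.
    by congr (_, _); apply: val_inj.
  by rewrite [RHS]tuple_eta; apply: val_inj.
under eq_bigr do rewrite walk_prob_cons.
rewrite -(pair_bigA _ (fun v (w : k.-tuple G) => if adj s v then
  (1 - alpha) / (deg s)%:R * walk_prob alpha v w else 0)) /=.
transitivity (\sum_(v in adj s) (1 - alpha) / (deg s)%:R * (alpha * (1 - alpha) ^+ k)).
  rewrite [RHS]big_mkcond; apply: eq_bigr => v _; rewrite -[v \in adj s]/(adj s v).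
  by case: (adj s v); [rewrite -mulr_sumr IH|rewrite big1].
rewrite sumr_const -mulr_natr -/(deg s) exprS; field.
by rewrite pnatr_eq0 -lt0n deg_gt0.
Qed.

End WalkLaw.

(** For [m = size w] this writes [walk_cost w] as a sum of indicators, so that its mean becomes a
    sum of survival probabilities. *)
Lemma nneseries_indicator_leq (R : realType) m :
  (\sum_(l <oo) ((l <= m)%N%:R : R)%:E = (m.+1%:R)%:E)%E.
Proof.
apply: cvg_lim => //; apply: cvg_near_cst; exists m.+1 => // n /= mn.
rewrite sumEFin -natr_sum; congr ((_%:R)%:E).
rewrite (@big_cat_nat _ _ _ m.+1) //=.
have -> : (\sum_(m.+1 <= i < n) (i <= m)%N)%N = 0%N.
  by rewrite big_nat big1 // => i /andP[mi _]; rewrite leqNgt mi.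
rewrite addn0 (@eq_big_nat _ _ _ _ _ _ (fun=> 1%N)) => [|i /andP[_ im]].
  by rewrite sum_nat_const_nat subn0 muln1.
by rewrite -ltnS im.
Qed.

Lemma nneseries_geometric (R : realType) (a z : R) : 0 <= z < 1 ->
  (\sum_(l <oo) (a * z ^+ l)%:E = (a / (1 - z))%:E)%E.
Proof.
case/andP=> z0 z1; apply: cvg_lim => //.
apply: cvg_EFin; first by apply: nearW => n; rewrite sumEFin.
rewrite [X in X @ _ --> _](_ : _ = series (geometric a z)); last first.
  by apply/funext => n /=; rewrite sumEFin.
by apply: cvg_geometric_series; rewrite ger0_norm.
Qed.

(** * Expected cost and endpoint of a simulated walk *)

Section IidWalks.
Variables (R : realType) (alpha : R) (G : ugraph) (s : G).
Variables (d : measure_display) (Omega : measurableType d).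
Variables (P : probability Omega R) (W : nat -> Omega -> seq G).
Hypotheses (alpha01 : 0 < alpha < 1) (iidW : iid_walks alpha s P W).

Lemma walk_preimage_measurable i A : measurable (W i @^-1` A).
Proof. by apply: countable_preimage_measurable; exact: (iid_walks_meas iidW). Qed.

Lemma walk_preimage_esum i A :
  (P (W i @^-1` A) = \esum_(w in A) (walk_prob alpha s w)%:E)%E.
Proof.
rewrite measure_preimage_esum; last exact: (iid_walks_meas iidW).
by apply: eq_esum => w _; exact: (iid_walks_law iidW).
Qed.

Lemma walk_size_prob i k :
  P (W i @^-1` [set w | size w = k]) = (alpha * (1 - alpha) ^+ k)%:E.
Proof.
rewrite walk_preimage_esum.
have -> : [set w | size w = k] = (fun w : k.-tuple G => tval w) @` setT.
  apply/seteqP; split => [w /= sw|_ [w _ <-] /=]; last exact: size_tuple.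
  by exists (tcast sw (in_tuple w)) => //; rewrite val_tcast.
rewrite esum_image; last by move=> x y _ _; exact: val_inj.
have -> : [set: k.-tuple G] = [set w | predT w] by apply/seteqP; split.
rewrite esum_finType.
  by rewrite sumEFin walk_mass_size.
by move=> w; rewrite lee_fin walk_prob_ge0.
Qed.

(** Subtracting the probability of length exactly [l] at each step of the induction avoids summing
    an infinite tail. *)
Lemma walk_survival_prob i l :
  P (W i @^-1` [set w | (l <= size w)%N]) = ((1 - alpha) ^+ l)%:E.
Proof.
elim: l => [|l IH].
  have -> : W i @^-1` [set w | (0 <= size w)%N] = setT by apply/seteqP; split.
  by rewrite probability_setT.
have U : W i @^-1` [set w | (l <= size w)%N] =
    W i @^-1` [set w | size w = l] `|` W i @^-1` [set w | (l < size w)%N].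
  apply/seteqP; split => x /=; first by rewrite leq_eqVlt => /orP[/eqP|]; [left|right].
  by case=> [->//|/ltnW].
have I0 : W i @^-1` [set w | size w = l] `&` W i @^-1` [set w | (l < size w)%N] = set0.
  by apply/seteqP; split => x //= [->]; rewrite ltnn.
have PU : (P (W i @^-1` [set w | (l <= size w)%N]) =
    P (W i @^-1` [set w | size w = l]) + P (W i @^-1` [set w | (l < size w)%N]))%E.
  by rewrite U; apply: measureU I0; exact: walk_preimage_measurable.
move: IH; rewrite PU.
rewrite walk_size_prob; set p := P _.
have /fineK <- : p \is a fin_num by apply: fin_num_measure; exact: walk_preimage_measurable.
by rewrite -EFinD => -[h]; congr (_%:E); rewrite exprS; lra.
Qed.

(** The survival probabilities sum to [1 / alpha]. The event [D] will be an outcome of Phase I and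
    [j] a walk of Phase III. *)
Lemma integral_walk_cost j (D : set Omega) : measurable D ->
  (forall A, P (D `&` W j @^-1` A) = P D * P (W j @^-1` A))%E ->
  (\int[P]_x (\1_D x * (walk_cost (W j x))%:R)%:E = P D * (alpha^-1)%:E)%E.
Proof.
move=> mD indep.
pose E l := D `&` W j @^-1` [set w | (l <= size w)%N].
have mE l : measurable (E l).
  by apply: measurableI => //; exact: walk_preimage_measurable.
transitivity (\int[P]_x \sum_(l <oo) (\1_(E l) x)%:E)%E.
  apply: eq_integral => x _; rewrite /walk_cost EFinM -nneseries_indicator_leq.
  rewrite -nneseriesZl; last by move=> l _; rewrite lee_fin.
  apply: eq_eseriesr => l _; rewrite -EFinM; congr (_%:E).
  rewrite /E indicI /=; congr (_ * _); rewrite indicE; congr (_%:R).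
  by congr nat_of_bool; apply/idP/idP; rewrite inE.
rewrite integral_nneseries //; last by move=> l; exact/measurable_EFinP/measurable_indic.
have IE l : (\int[P]_x (\1_(E l) x)%:E = P D * ((1 - alpha) ^+ l)%:E)%E.
  rewrite integral_indic // setIT.
  by move: (indep [set w | (l <= size w)%N]); rewrite walk_survival_prob => <-.
rewrite (eq_eseriesr (fun l _ => IE l)).
have /fineK <- : P D \is a fin_num by exact: fin_num_measure.
under eq_eseriesr do rewrite -EFinM.
rewrite nneseries_geometric; first by rewrite opprB addrCA subrr addr0 EFinM.
by case/andP: alpha01 => a0 a1; lra.
Qed.

Lemma integral_walk_cost1 j :
  (\int[P]_x ((walk_cost (W j x))%:R)%:E = (alpha^-1)%:E)%E.
Proof.
rewrite -[RHS]mul1e -(@probability_setT _ _ _ P) -(@integral_walk_cost j setT) //.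
  by apply: eq_integral => x _; rewrite indicT mul1r.
by move=> A; rewrite setTI probability_setT mul1e.
Qed.

Lemma walk_cost_measurable j (D : set Omega) : measurable D ->
  measurable_fun setT (fun x => (\1_D x * (walk_cost (W j x))%:R)%:E : \bar R).
Proof.
move=> mD; apply/measurable_EFinP; apply: measurable_funM; first exact: measurable_indic.
apply: (countable_comp_measurable _ (fun w => (walk_cost w)%:R : R)).
exact: (iid_walks_meas iidW).
Qed.

(** The sum over a finite set of walks is the integral of the cost of walk 0 on the disjoint events
    that it equals one of them, hence at most the full integral. *)
Lemma mean_walk_cost_esum_le :
  (\esum_(w in [set: seq G]) (walk_prob alpha s w * (walk_cost w)%:R)%:E <=
    (alpha^-1)%:E)%E.
Proof.
apply: ub_ereal_sup => _ [X [fX _] <-]; rewrite fsbig_finite //=.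
have uX := finmap.fset_uniq (fset_set X); set F := finmap.enum_fset _ in uX *.
rewrite -(integral_walk_cost1 0).
pose f w x := (\1_(W 0%N @^-1` [set w]) x * (walk_cost (W 0%N x))%:R)%:E : \bar R.
have mf w : measurable_fun setT (f w).
  by apply: walk_cost_measurable; exact: (iid_walks_meas iidW).
have f0 w x : (0 <= f w x)%E by rewrite lee_fin mulr_ge0.
rewrite (eq_bigr (fun w => \int[P]_x f w x)%E) => [|w _]; last first.
  transitivity (\int[P]_x ((walk_cost w)%:R%:E * (\1_(W 0%N @^-1` [set w]) x)%:E))%E.
    rewrite ge0_integralZl //.
    - rewrite integral_indic //; last exact: (iid_walks_meas iidW).
      by rewrite setIT EFinM muleC; congr (_ * _)%E; rewrite -(iid_walks_law iidW 0).
    - by apply/measurable_EFinP/measurable_indic; exact: (iid_walks_meas iidW).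
  apply: eq_integral => x _; rewrite -EFinM mulrC /f; congr (_%:E).
  by rewrite indicE; case: (boolP (x \in _)) => [|_]; rewrite ?inE ?mul0r //= => ->.
rewrite -ge0_integral_sum //; apply: ge0_le_integral => //.
- by move=> x _; apply: sume_ge0 => w _.
- exact: emeasurable_sum.
- apply/measurable_EFinP/(countable_comp_measurable _ (fun w => (walk_cost w)%:R : R)).
  exact: (iid_walks_meas iidW).
move=> x _; rewrite sumEFin lee_fin -mulr_suml -[leRHS]mul1r ler_wpM2r //.
rewrite (eq_bigr (fun w => (W 0%N x == w)%:R)) => [|w _]; last first.
  by rewrite indicE; congr (_%:R); congr nat_of_bool; apply/idP/eqP; rewrite inE.
rewrite -natr_sum (ler_nat _ _ 1).
have -> : (\sum_(w <- F) (W 0%N x == w) = count_mem (W 0%N x) F)%N.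
  by rewrite -sum1_count [RHS]big_mkcond; apply: eq_bigr => w _; rewrite /= eq_sym; case: eqP.
by rewrite count_uniq_mem // leq_b1.
Qed.

Lemma mean_walk_cost_le : mean_walk_cost alpha s <= alpha^-1.
Proof.
have := mean_walk_cost_esum_le; rewrite /mean_walk_cost; set e := esum _ _.
have : (0 <= e)%E by apply: esum_ge0 => w _; rewrite lee_fin mulr_ge0 ?walk_prob_ge0.
by case: e => [r||] //=; rewrite leNgt ltry.
Qed.

(** Every walk costs at least one unit and the probabilities sum to 1. Finiteness has to come first,
    since [fine] sends [+oo] to 0. *)
Lemma mean_walk_cost_ge1 : 1 <= mean_walk_cost alpha s.
Proof.
rewrite -lee_fin -(@probability_setT _ _ _ P) -[setT]/(W 0%N @^-1` setT).
rewrite (walk_preimage_esum 0) /mean_walk_cost fineK //.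
  apply: le_esum => w _; rewrite lee_fin -[leLHS]mulr1 ler_wpM2l ?walk_prob_ge0 //.
  by rewrite ler1n.
rewrite ge0_fin_numE; last first.
  by apply: esum_ge0 => w _; rewrite lee_fin mulr_ge0 ?walk_prob_ge0.
by apply: le_lt_trans mean_walk_cost_esum_le _; rewrite ltry.
Qed.

Lemma ppr_prob i v :
  P (W i @^-1` [set w | last s w = v]) = (ppr alpha s v)%:E.
Proof.
rewrite /ppr -(walk_preimage_esum i) fineK //.
by apply: fin_num_measure; exact: walk_preimage_measurable.
Qed.

Lemma ppr_ge0 v : 0 <= ppr alpha s v.
Proof. by rewrite -lee_fin -(ppr_prob 0). Qed.

Lemma sum_ppr : \sum_v ppr alpha s v = 1.
Proof.
apply/eqP; rewrite -eqe -sumEFin; apply/eqP.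
under eq_bigr do rewrite -(ppr_prob 0).
have := @measure_preimage_sum _ _ _ P _ (fun x => last s (W 0%N x)) predT.
move=> /= <-; first by rewrite (_ : mkset _ = setT) ?probability_setT //; apply/seteqP; split.
by move=> v; exact: (walk_preimage_measurable 0 [set w | last s w = v]).
Qed.

End IidWalks.

(** * Expected cost of a block of walks on an event *)

Section BlockIntegral.
Variables (R : realType) (alpha : R) (G : ugraph) (s : G).
Variables (d : measure_display) (Omega : measurableType d).
Variables (P : probability Omega R) (W : nat -> Omega -> seq G).
Hypotheses (alpha01 : 0 < alpha < 1) (iidW : iid_walks alpha s P W).

(** The running time is a sum of such terms: one for Phase I, and one for each of its outcomes [D],
    on which the overhead [c] and the indices [js] of the later walks are constant. *)
Definition block_cost (D : set Omega) (c : nat) (js : seq nat) (x : Omega) : \bar R :=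
  (\1_D x * (c + \sum_(j <- js) walk_cost (W j x))%:R)%:E.

Lemma block_costE D c js : block_cost D c js =
  (fun x => (c%:R%:E * (\1_D x)%:E) +
            \sum_(j <- js) (\1_D x * (walk_cost (W j x))%:R)%:E)%E.
Proof.
apply/funext => x; rewrite /block_cost sumEFin -EFinM -EFinD natrD natr_sum.
by rewrite mulrDr mulr_sumr mulrC.
Qed.

Lemma block_cost_ge0 D c js x : (0 <= block_cost D c js x)%E.
Proof. by rewrite lee_fin mulr_ge0. Qed.

Variable D : set Omega.
Hypothesis mD : measurable D.

Let mcst c : measurable_fun setT (fun x => (c%:R%:E * (\1_D x)%:E)%E : \bar R).
Proof. by apply: measurable_funeM; exact/measurable_EFinP/measurable_indic. Qed.

Let mwc j := walk_cost_measurable iidW j mD.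

Lemma block_cost_measurable c js : measurable_fun setT (block_cost D c js).
Proof.
by rewrite block_costE; apply: emeasurable_funD => //; apply: emeasurable_sum.
Qed.

Lemma integral_block_cost c js :
  (forall j A, j \in js -> P (D `&` W j @^-1` A) = P D * P (W j @^-1` A))%E ->
  (\int[P]_x block_cost D c js x = P D * (c%:R + (size js)%:R / alpha)%:E)%E.
Proof.
move=> indep; rewrite block_costE.
have i0 x : (0 <= (\1_D x)%:E :> \bar R)%E by rewrite lee_fin.
have mi : measurable_fun setT (fun x => (\1_D x)%:E : \bar R).
  exact/measurable_EFinP/measurable_indic.
have c0 x : (0 <= c%:R%:E * (\1_D x)%:E :> \bar R)%E by rewrite mule_ge0 // lee_fin.
have w0 j x : (0 <= (\1_D x * (walk_cost (W j x))%:R)%:E :> \bar R)%E.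
  by rewrite lee_fin mulr_ge0.
have ws0 x : (0 <= \sum_(j <- js) (\1_D x * (walk_cost (W j x))%:R)%:E :> \bar R)%E.
  by apply: sume_ge0 => j _.
have mws : measurable_fun setT
    (fun x => \sum_(j <- js) (\1_D x * (walk_cost (W j x))%:R)%:E : \bar R)%E.
  exact: emeasurable_sum.
rewrite ge0_integralD // ge0_integral_sum // ge0_integralZl //.
have -> : (\int[P]_x (\1_D x)%:E = P D)%E by rewrite integral_indic // setIT.
rewrite (eq_big_seq (fun=> P D * (alpha^-1)%:E)%E) => [|j jjs]; last first.
  by apply: (integral_walk_cost alpha01 iidW) => // A; apply: indep.
have /fineK <- : P D \is a fin_num by exact: fin_num_measure.
rewrite -!EFinM sumEFin -EFinD; congr (_%:E).
rewrite big_const_seq count_predT iter_addr_0 -mulr_natr; ring.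
Qed.

End BlockIntegral.

(** * The outcome of Phase I as a finite random element *)

Section Endpoints.
Variables (R : realType) (alpha : R) (G : ugraph) (s : G).
Variables (d : measure_display) (Omega : measurableType d).
Variables (P : probability Omega R) (W : nat -> Omega -> seq G).
Hypotheses (alpha01 : 0 < alpha < 1) (iidW : iid_walks alpha s P W).
Variable m : nat.

(** The estimates depend on the walks only through their endpoints. These take finitely many values,
    so conditioning on them is a finite sum. *)
Definition endpoints (x : Omega) : {ffun 'I_m -> G} := [ffun i : 'I_m => last s (W i x)].

Definition empirical (e : {ffun 'I_m -> G}) (v : G) : R :=
  (\sum_(i < m) (e i == v))%:R / m%:R.

Lemma monte_carlo_endpoints x :
  monte_carlo R s [seq W j x | j <- iota 0 m] = empirical (endpoints x).
Proof.
apply/funext => v; rewrite /monte_carlo /empirical size_map size_iota.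
congr (_%:R / _); rewrite count_map -sum1_count big_mkcond /=.
have -> : iota 0 m = index_iota 0 m by rewrite /index_iota subn0.
rewrite big_mkord; apply: eq_bigr => i _.
by rewrite ffunE; case: eqP.
Qed.

Lemma empirical_ge0 e v : 0 <= empirical e v.
Proof. by rewrite divr_ge0. Qed.

Lemma sum_empirical_le1 e : \sum_v empirical e v <= 1.
Proof.
rewrite -mulr_suml -natr_sum exchange_big /=.
rewrite (eq_bigr (fun=> 1%N)) => [|i _]; last first.
  rewrite (bigD1 (e i)) //= eqxx big1 // => v; rewrite eq_sym; case: eqP => //.
(* Division by 0 gives 0, so the total mass is 0 for [m = 0] and 1 otherwise. *)
rewrite sum1_card card_ord; have [->|m0] := eqVneq m 0%N; first by rewrite mul0r.
by rewrite divff // pnatr_eq0.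
Qed.

(** Independence is stated for families indexed by [nat]; for [i >= m] the condition is vacuous and
    the cell is everything. *)
Definition endpoint_cell (e : {ffun 'I_m -> G}) (i : nat) : set (seq G) :=
  [set w | forall H : (i < m)%N, last s w = e (Ordinal H)].

Lemma endpoints_preimage e : endpoints @^-1` [set e] =
  \big[setI/setT]_(i <- iota 0 m) (W i @^-1` endpoint_cell e i).
Proof.
rewrite -bigcap_seq; apply/seteqP; split => [x /= <- i _ H|x H].
  by rewrite ffunE.
apply/ffunP => i; rewrite ffunE.
have /= := H i; rewrite mem_iota add0n => /(_ (ltn_ord i)) /(_ (ltn_ord i)) ->.
by congr (e _); apply: val_inj.
Qed.

Lemma endpoints_measurable e : measurable (endpoints @^-1` [set e]).
Proof.
rewrite endpoints_preimage; apply: bigsetI_measurable => i _.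
exact: (walk_preimage_measurable iidW).
Qed.

(** Independence is applied to the indices below [m] together with [j]; as [j] is new, [B] can take
    the value [A] there without changing the cells. *)
Lemma endpoints_indep e j A : (m <= j)%N ->
  (P (endpoints @^-1` [set e] `&` W j @^-1` A) =
   P (endpoints @^-1` [set e]) * P (W j @^-1` A))%E.
Proof.
move=> mj; pose B i := if i == j then A else endpoint_cell e i.
have jm : j \notin iota 0 m by rewrite mem_iota add0n -leqNgt.
have Bi i : i \in iota 0 m -> B i = endpoint_cell e i.
  by move=> im; rewrite /B; case: eqP im jm => // -> ->.
have := iid_walks_indep iidW B (_ : uniq (j :: iota 0 m)).
rewrite !big_cons {1 3}/B eqxx /= jm iota_uniq => /(_ isT).
rewrite (eq_big_seq (fun i => W i @^-1` endpoint_cell e i)) => [|i /Bi -> //].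
rewrite -endpoints_preimage setIC => ->; rewrite muleC; congr (_ * _)%E.
rewrite endpoints_preimage (iid_walks_indep iidW) ?iota_uniq //.
by apply: eq_big_seq => i /Bi ->.
Qed.

Definition endpoints_prob e : R := fine (P (endpoints @^-1` [set e])).

Lemma endpoints_probE e : (endpoints_prob e)%:E = P (endpoints @^-1` [set e]).
Proof. by rewrite fineK //; apply: fin_num_measure; exact: endpoints_measurable. Qed.

Lemma endpoints_prob_ge0 e : 0 <= endpoints_prob e.
Proof. by rewrite fine_ge0. Qed.

Lemma sum_endpoints_prob : \sum_e endpoints_prob e = 1.
Proof.
apply/eqP; rewrite -eqe -sumEFin; apply/eqP.
under eq_bigr do rewrite endpoints_probE.
rewrite -(@measure_preimage_sum _ _ _ P _ endpoints predT) /=; last exact: endpoints_measurable.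
by rewrite (_ : mkset _ = setT) ?probability_setT //; apply/seteqP; split.
Qed.

(** The Monte Carlo estimate is unbiased for [m > 0]; for [m = 0] it is 0. *)
Lemma mean_empirical_le v :
  \sum_e endpoints_prob e * empirical e v <= ppr alpha s v.
Proof.
have H (i : 'I_m) : \sum_e endpoints_prob e * (e i == v)%:R = ppr alpha s v.
  apply/eqP; rewrite -eqe -sumEFin; apply/eqP.
  rewrite -(ppr_prob iidW i v).
  have := @measure_preimage_sum _ _ _ P _ endpoints (fun e => e i == v) endpoints_measurable.
  rewrite big_mkcond /= (_ : mkset _ = W i @^-1` [set w | last s w = v]); last first.
    by apply/seteqP; split => x /=; rewrite ffunE => /eqP.
  move=> ->; apply: eq_bigr => e _; rewrite EFinM endpoints_probE.
  by case: eqP => _; rewrite ?mule1 ?mule0.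
rewrite /empirical (eq_bigr (fun e =>
    (\sum_(i < m) endpoints_prob e * (e i == v)%:R) / m%:R)); last first.
  by move=> e _; rewrite natr_sum mulrA mulr_sumr.
rewrite -mulr_suml exchange_big /= (eq_bigr (fun=> ppr alpha s v)) //.
rewrite sumr_const card_ord -(mulr_natr (ppr alpha s v)) -mulrA; have [->|m0] := eqVneq m 0%N.
  by rewrite mul0r mulr0 (ppr_ge0 iidW).
by rewrite divff ?mulr1 // pnatr_eq0.
Qed.

End Endpoints.

(** * Expected running time on one input *)

Section Time.
Variables (R : realType) (alpha : R) (G : ugraph).
Variables (ord : push_order R G) (s : G) (eps : R).

Definition overhead (pi1 : G -> R) : nat :=
  (phase2_cost alpha ord s eps pi1
   + \sum_(0 <= i < n_t R G) \sum_(t in candidates eps pi1)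
      (1 + #|[pred v | bp_residue alpha ord t
                (r_max eps pi1 (stop_index alpha ord s eps pi1) t) v != 0%R]|)
   + \sum_(t in candidates eps pi1) n_t R G)%N.

Definition phase3_indices (pi1 : G -> R) : seq nat :=
  let nr := n_r G eps (stop_index alpha ord s eps pi1) in
  flatten [seq iota (n_first G eps + i * nr) nr | i <- index_iota 0 (n_t R G)].

Lemma size_phase3_indices pi1 : size (phase3_indices pi1) =
  (n_t R G * n_r G eps (stop_index alpha ord s eps pi1))%N.
Proof.
rewrite size_flatten /shape -map_comp sumnE big_map.
under eq_bigr do rewrite /= size_iota.
by rewrite sum_nat_const_nat subn0.
Qed.

Lemma phase3_indices_ge pi1 j : j \in phase3_indices pi1 -> (n_first G eps <= j)%N.
Proof.
case/flattenP => _ /mapP[i _ ->]; rewrite mem_iota => /andP[+ _].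
by apply: leq_trans; rewrite leq_addr.
Qed.

(** This isolates the walks of Phase I; the remaining overhead and the indices of the remaining
    walks are functions of [pi1] alone. *)
Lemma ssppr_time (W : nat -> seq G) :
  let pi1 := monte_carlo R s [seq W j | j <- iota 0 (n_first G eps)] in
  (ssppr alpha ord s eps W).2 =
  (n_first G eps + \sum_(j <- iota 0 (n_first G eps)) walk_cost (W j)
   + (overhead pi1 + \sum_(j <- phase3_indices pi1) walk_cost (W j)))%N.
Proof.
move=> pi1; rewrite /ssppr /= -/pi1 big_map big_split /=.
rewrite /phase3_indices /overhead big_flatten /= big_map.
set nr := n_r _ _ _.
have -> : (\sum_(0 <= i < n_t R G) \sum_(w <- [seq W j | j <- iota (n_first G eps + i * nr) nr])
    walk_cost w = \sum_(0 <= i < n_t R G) \sum_(j <- iota (n_first G eps + i * nr) nr)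
    walk_cost (W j))%N by apply: eq_bigr => i _; rewrite big_map.
lia.
Qed.

Hypotheses (alpha01 : 0 < alpha < 1) (ordP : valid_order alpha ord).
Hypothesis eps01 : 0 < eps <= 1.
Variables (d : measure_display) (Omega : measurableType d).
Variables (P : probability Omega R) (W : nat -> Omega -> seq G).
Hypothesis iidW : iid_walks alpha s P W.

Local Notation m := (n_first G eps).
Local Notation D := (\sum_t ppr alpha s t * (deg t)%:R).

(** It makes the division by [sqrt D] below legitimate and lets [sqrt D] absorb additive terms. *)
Lemma ppr_degree_ge1 : 1 <= D.
Proof.
rewrite -[leLHS](sum_ppr iidW); apply: ler_sum => t _.
by rewrite -[leLHS]mulr1 ler_wpM2l ?(ppr_ge0 iidW) // ler1n deg_gt0.
Qed.

Lemma ppr_degree_le_dmax : D <= (dmax G)%:R.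
Proof.
rewrite -[leRHS]mul1r -[X in _ <= X * _](sum_ppr iidW) mulr_suml; apply: ler_sum => t _.
by rewrite ler_wpM2l ?(ppr_ge0 iidW) // ler_nat /dmax leq_bigmax.
Qed.

(* AM-GM, [2 sqrt x <= x / sqrt D + sqrt D], replaces Jensen's inequality. *)
Lemma mean_sqrt_empirical_le :
  \sum_e endpoints_prob s P W (m := m) e *
    Num.sqrt (\sum_t empirical R e t * (deg t)%:R) <= Num.sqrt D.
Proof.
pose p := endpoints_prob s P W (m := m).
pose X (e : {ffun 'I_m -> G}) := \sum_t empirical R e t * (deg t)%:R.
have p0 e : 0 <= p e := endpoints_prob_ge0 s P W e.
have X0 e : 0 <= X e by apply: sumr_ge0 => t _; rewrite mulr_ge0 ?empirical_ge0.
have D1 := ppr_degree_ge1; set r := Num.sqrt D.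
have r2 : r ^+ 2 = D by rewrite sqr_sqrtr //; lra.
have r0 : 0 < r by rewrite sqrtr_gt0; lra.
have EX : \sum_e p e * X e <= D.
  under eq_bigr do rewrite mulr_sumr.
  rewrite exchange_big /=; apply: ler_sum => t _.
  under eq_bigr do rewrite mulrA.
  by rewrite -mulr_suml ler_wpM2r // (mean_empirical_le iidW).
rewrite -(ler_pM2l r0) -expr2 r2 mulr_sumr.
apply: (@le_trans _ _ (\sum_e (p e * X e + p e * D) / 2)).
  apply: ler_sum => e _; rewrite -/(p e) -/(X e) -r2 -mulrDr mulrCA -mulrA ler_wpM2l //.
  have /sqr_sqrtr {2}<- := X0 e.
  have := sqr_ge0 (r - Num.sqrt (X e)); nra.
rewrite -mulr_suml big_split /= -mulr_suml (sum_endpoints_prob iidW) mul1r; lra.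
Qed.

(** The number of walks in Phase III is random, but constant on each event fixing the endpoints [e]
    of Phase I, and those walks are independent of that event. There [cost_given_estimates_le]
    applies to the empirical measure; then one averages over [e]. *)
Lemma integral_time_le :
  (\int[P]_x ((ssppr alpha ord s eps (W ^~ x)).2%:R)%:E <=
   (m%:R * (1 + alpha^-1) +
    80 * (n_t R G)%:R ^+ 2 / (alpha ^+ 2 * eps) * (1 + Num.sqrt D))%:E)%E.
Proof.
pose Y := endpoints s W m.
pose ov e := overhead (empirical R (e : {ffun 'I_m -> G})).
pose js e := phase3_indices (empirical R (e : {ffun 'I_m -> G})).
have mY e : measurable (Y @^-1` [set e]) := endpoints_measurable iidW e.
have TE x : (((ssppr alpha ord s eps (W ^~ x)).2%:R)%:E =
    block_cost R W setT m (iota 0 m) x +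
    \sum_e block_cost R W (Y @^-1` [set e]) (ov e) (js e) x)%E.
  rewrite ssppr_time monte_carlo_endpoints natrD EFinD; congr (_ + _)%E.
    by rewrite /block_cost indicT mul1r.
  rewrite (bigD1 (Y x)) //= [X in (_ + X)%E]big1 => [|e eY].
    by rewrite adde0 /block_cost indicE mem_set // mul1r.
  by rewrite /block_cost indicE memNset ?mul0r // => /= Yx; rewrite Yx eqxx in eY.
have bm (e : {ffun 'I_m -> G}) := block_cost_measurable iidW (mY e) (ov e) (js e).
have b0 (e : {ffun 'I_m -> G}) x := block_cost_ge0 R W (Y @^-1` [set e]) (ov e) (js e) x.
under eq_integral do rewrite TE.
rewrite ge0_integralD //; last 4 first.
- by move=> x _; exact: block_cost_ge0.
- exact: (block_cost_measurable iidW).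
- by move=> x _; apply: sume_ge0 => e _.
- exact: emeasurable_sum.
rewrite ge0_integral_sum // (integral_block_cost alpha01 iidW) //; last first.
  by move=> j A _; rewrite setTI probability_setT mul1e.
rewrite probability_setT mul1e size_iota.
rewrite (eq_bigr (fun e => (endpoints_prob s P W e *
    ((ov e)%:R + (size (js e))%:R / alpha))%:E)) => [|e _]; last first.
  rewrite (integral_block_cost alpha01 iidW) // => [|j A jjs].
    by rewrite EFinM (endpoints_probE iidW).
  by apply: (endpoints_indep iidW); exact: phase3_indices_ge jjs.
rewrite sumEFin -EFinD lee_fin lerD //; first by rewrite mulrDr mulr1.
have mwc : 1 <= mean_walk_cost alpha s <= alpha^-1.
  by rewrite (mean_walk_cost_ge1 alpha01 iidW) (mean_walk_cost_le alpha01 iidW).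
set c := 80 * _ / _.
have c0 : 0 <= c.
  case/andP: alpha01 => a0 _; case/andP: eps01 => e0 _.
  by rewrite divr_ge0 // mulr_ge0 ?exprn_ge0 // ltW.
apply: (@le_trans _ _ (\sum_(e : {ffun 'I_m -> G}) (c * endpoints_prob s P W e +
   c * (endpoints_prob s P W e * Num.sqrt (\sum_t empirical R e t * (deg t)%:R))))).
  apply: ler_sum => e _; rewrite -mulrDr -{2}[endpoints_prob _ _ _ _]mulr1 -mulrDr mulrCA.
  rewrite ler_wpM2l ?endpoints_prob_ge0 //.
  have := cost_given_estimates_le alpha01 ordP eps01 (empirical_ge0 R e)
    (sum_empirical_le1 R e) mwc.
  by rewrite -/c size_phase3_indices /ov /overhead !natrD.
rewrite big_split /= -!mulr_sumr (sum_endpoints_prob iidW) mulrDr lerD2l.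
by rewrite ler_wpM2l // mean_sqrt_empirical_le.
Qed.

End Time.

(** * The bound uniform over all inputs *)

Theorem theorem12 (R : realType) (alpha : R) (alpha01 : 0 < alpha < 1) :
  let bound (x : input alpha) : R :=
    (eps x)^-1 *
    Num.sqrt (\sum_(t : graph x) ppr alpha (source x) t * (deg t)%:R) in
  let bound_dmax (x : input alpha) : R :=
    Num.sqrt (dmax (graph x))%:R / eps x in
  [/\ softO (@expected_time R alpha) bound,
      softO (fun x => (bound x)%:E) bound_dmax &
      softO (@expected_time R alpha) bound_dmax].
Proof.
move=> bound bound_dmax; have /andP[a0 a1] := alpha01.
have bound_le x : bound x <= bound_dmax x.
  have /andP[e0 _] := eps_range x.
  rewrite /bound /bound_dmax mulrC ler_wpM2r ?invr_ge0 ?(ltW e0) // ler_sqrt //.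
  exact: (ppr_degree_le_dmax (walks_iid x)).
(* Phase I gives 200 = 50 * 2 * 2, from [1 + 1 / alpha <= 2 / alpha ^+ 2] and [L <= 2 * L ^+ 2]. The
   rest gives 80 * 2 * 56 ^ 2, from [1 + S <= 2 * S] and [n_t <= 56 * L]. *)
pose K : R := (200 + 160 * 56 ^+ 2) / alpha ^+ 2.
have K0 : 0 <= K by rewrite divr_ge0 ?exprn_ge0 ?(ltW a0) // addr_ge0 ?mulr_ge0 ?exprn_ge0.
have main x : (expected_time x <= (K * ln #|graph x|%:R ^+ 2 * bound x)%:E)%E.
  have /andP[e0 e1] := eps_range x.
  rewrite /expected_time unlock.
  apply: le_trans (integral_time_le alpha01 (@rule_valid _ _ x) (eps_range x) (walks_iid x)) _.
  rewrite lee_fin /bound.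
  have := ppr_degree_ge1 (walks_iid x).
  set D := \sum_t _ => D1; set S := Num.sqrt D; set L := ln _.
  have S1 : 1 <= S by rewrite -[leLHS]sqrtr1 ler_sqrt //; lra.
  have L2 : 1 / 2 <= L := ln_card_ge_half R (source x).
  have mL : (n_first (graph x) (eps x))%:R <= 50 * L / eps x := n_first_le (source x) (eps_range x).
  have NL : (n_t R (graph x))%:R <= 56 * L := n_t_le R (source x).
  have N2 : (n_t R (graph x))%:R ^+ 2 <= (56 * L) ^+ 2 by rewrite lerXn2r ?nnegrE //; lra.
  have ia : 1 <= alpha^-1 by rewrite invf_ge1 // ltW.
  have ie : 0 < (eps x)^-1 by rewrite invr_gt0.
  have i2 : 0 < (alpha ^+ 2 * eps x)^-1 by rewrite invr_gt0 mulr_gt0 ?exprn_gt0.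
  have LL : L <= 2 * L ^+ 2 by rewrite expr2; nra.
  have t1 : (n_first (graph x) (eps x))%:R * (1 + alpha^-1) <=
      200 * (L ^+ 2 / (alpha ^+ 2 * eps x)) * S.
    apply: le_trans (_ : 100 * L / (alpha ^+ 2 * eps x) <= _); last first.
      apply: le_trans (_ : 200 * (L ^+ 2 / (alpha ^+ 2 * eps x)) <= _).
        rewrite mulrA ler_pM2r //; lra.
      by rewrite -[leLHS]mulr1 ler_wpM2l // !mulr_ge0 ?exprn_ge0 ?(ltW i2) //; lra.
    apply: le_trans (_ : 50 * L / eps x * (2 * alpha ^- 2) <= _); last first.
      by rewrite le_eqVlt; apply/orP; left; apply/eqP; field; rewrite !gt_eqF.
    apply: ler_pM => //; first by rewrite addr_ge0 //; lra.
    rewrite -exprVn expr2; nra.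
  have t2 : 80 * (n_t R (graph x))%:R ^+ 2 / (alpha ^+ 2 * eps x) * (1 + S) <=
      160 * 56 ^+ 2 * (L ^+ 2 / (alpha ^+ 2 * eps x)) * S.
    rewrite (_ : 160 * 56 ^+ 2 * (L ^+ 2 / (alpha ^+ 2 * eps x)) * S =
      80 * (56 * L) ^+ 2 / (alpha ^+ 2 * eps x) * (2 * S)); last by ring.
    apply: ler_pM; rewrite ?mulr_ge0 ?exprn_ge0 ?(ltW i2) //; [lra| |lra].
    by rewrite ler_pM2r // ler_pM2l.
  rewrite (_ : K * L ^+ 2 * ((eps x)^-1 * S) =
    200 * (L ^+ 2 / (alpha ^+ 2 * eps x)) * S +
    160 * 56 ^+ 2 * (L ^+ 2 / (alpha ^+ 2 * eps x)) * S); first exact: lerD.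
  by rewrite /K; field; rewrite !gt_eqF.
split.
- by exists K, 2%N.
- by exists 1, 0%N => x; rewrite lee_fin expr0 !mul1r.
- exists K, 2%N => x; apply: le_trans (main x) _.
  by rewrite lee_fin ler_wpM2l // mulr_ge0 // sqr_ge0.
Qed.
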